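(* For the distributed minimum variance estimator described in the context, for every node $i$, every $t\ge1$ and any packet loss realization $\varphi_{i|t}$ of $\phi_i(t)$, the optimal values of $\mathbf{k}_i(t)$ and $\mathbf{h}_i(t)$ are such that the error variance at node $i$ satisfies $$\mathbb{E}_v\big(e_i(t)-\mathbb{E}_v e_i(t)\,\big|\,\phi_i(t)=\varphi_{i|t}\big)^2<\frac{\sigma^2}{|\mathcal{N}_{\varphi_i}|}.$$
   Context: Setting. There are $N>1$ nodes; $\mathcal{N}_i$ is the set consisting of node $i$ and its neighbors in a fixed graph on $\{1,\dots,N\}$. At each $t\in\mathbb{N}_0$ node $i$ measures $u_i(t)=d(t)+v_i(t)$, where $d(t)$ is a scalar signal and the $v_i(t)$ are zero-mean Gaussian with variance $\sigma^2>0$, uncorrelated between distinct nodes and over time. $\phi_{ij}(t)\in\{0,1\}$ indicates that node $i$ receives the packet of node $j$ at time $t$; $\phi_{ii}(t)=1$ always and $\phi_{ij}(t)=0$ for $j\notin\mathcal{N}_i$; for $i\ne j$ these variables are independent among links and over time and independent of the noise. $\phi_i(t)=(\phi_{i1}(t),\dots,\phi_{iN}(t))^T$, with realization $\varphi_{i|t}$, and $\mathcal{N}_{\varphi_i}=\{j\in\mathcal{N}_i:\text{the }j\text{-th component of }\varphi_{i|t}\text{ is }1\}$. Estimator. $x_i(0)=u_i(0)$ and, for $t\ge1$, $x_i(t)=(\mathbf{k}_i(t)\circ\varphi_{i|t})^T\mathbf{x}(t-1)+(\mathbf{h}_i(t)\circ\varphi_{i|t})^T\mathbf{u}(t)$,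 with $\mathbf{x}=(x_1,\dots,x_N)^T$, $\mathbf{u}=(u_1,\dots,u_N)^T$, $\circ$ the Hadamard product. The error is $e_i(t)=x_i(t)-d(t)$; $\mathbb{E}_v$ is expectation over the measurement noise for given packet losses. $\mathbf{P}(t-1)$ is the $N\times N$ covariance matrix (with respect to the noise) of $(e_1(t-1),\dots,e_N(t-1))^T$. At each $t\ge1$, given $\mathbf{P}(t-1)$ and $\varphi_{i|t}$, the optimal weights $\mathbf{k}_i(t),\mathbf{h}_i(t)\in\mathbb{R}^N$ are those minimizing the error variance $\mathbb{E}_v(e_i(t)-\mathbb{E}_ve_i(t)|\phi_i(t)=\varphi_{i|t})^2=(\mathbf{k}_i\circ\varphi_{i|t})^T\mathbf{P}(t-1)(\mathbf{k}_i\circ\varphi_{i|t})+\sigma^2\|\mathbf{h}_i\circ\varphi_{i|t}\|^2$ subject to $\big((\mathbf{k}_i+\mathbf{h}_i)\circ\varphi_{i|t}\big)^T\mathbf{1}=1$ and $\|\mathbf{k}_i\circ\varphi_{i|t}\|^2\le\psi_i(t)$. Thresholds. $0<\gamma_{\max}<1$ is fixed and the thresholds $\psi_i(t)>0$ satisfy $\psi_i(t)+\sqrt{\psi_i(t)}\sum_{j\in\Theta_{\varphi_i}}\sqrt{\psi_j(t)}\le\gamma_{\max}$ for all $i$, where $\Theta_{\varphi_i}=\{j\ne i:\mathcal{N}_{\varphi_i}\cap\mathcal{N}_{\varphi_j}\ne\emptyset\}\cup(\mathcal{N}_{\varphi_i}\setminus\{i\})$. *)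

(* Defs.v *)
From HB Require Import structures.
From mathcomp Require Export all_boot all_order all_algebra.
From mathcomp Require Export all_classical all_reals all_analysis.

Set Implicit Arguments.
Unset Strict Implicit.
Unset Printing Implicit Defensive.

Import Order.TTheory GRing.Theory Num.Theory.

Local Open Scope classical_set_scope.
Local Open Scope ring_scope.

Definition dotv (R : realType) (N : nat) (a b : 'cV[R]_N) : R :=
  \sum_j a j 0 * b j 0.

(* Squared Euclidean norm; the library norm on matrices is the sup norm. *)
Definition sqnorm (R : realType) (N : nat) (a : 'cV[R]_N) : R := dotv a a.

Definition hadamard (R : realType) (N : nat) (a b : 'cV[R]_N) : 'cV[R]_N :=
  \col_j (a j 0 * b j 0).

(* [L i j] is true iff node i receives the packet of node j. *)
Definition lossmx (N : nat) := 'M[bool]_N.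

(* The vector varphi_{i|t} when [L] is the loss matrix at time t. *)
Definition loss_row (R : realType) (N : nat) (L : lossmx N) (i : 'I_N) :
  'cV[R]_N := \col_j (L i j)%:R.

Definition nbhd (N : nat) (adj : rel 'I_N) (i : 'I_N) : {set 'I_N} :=
  [set j | (j == i) || adj i j].

Definition rnbhd (N : nat) (adj : rel 'I_N) (L : lossmx N) (i : 'I_N) :
  {set 'I_N} := [set j in nbhd adj i | L i j].

Definition Theta (N : nat) (adj : rel 'I_N) (L : lossmx N) (i : 'I_N) :
    {set 'I_N} :=
  [set j | (j != i) && (rnbhd adj L i :&: rnbhd adj L j != finset.set0)]
  :|: (rnbhd adj L i :\ i).

Definition hist (N : nat) (phi : nat -> lossmx N) (t : nat) :
  seq (lossmx N) := mkseq phi t.+1.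

(* Weights and thresholds may depend on the losses up to the current time
   (P(t-1) is itself determined by the losses up to time t-1): their values at
   time t and node i are [k (hist phi t) i], [h (hist phi t) i] and
   [psi (hist phi t) i]. *)
Definition policy (N : nat) (V : Type) := seq (lossmx N) -> 'I_N -> V.

Fixpoint estimate (R : realType) (N : nat) (k h : policy N 'cV[R]_N)
    (u : nat -> 'cV[R]_N) (phi : nat -> lossmx N) (t : nat) : 'cV[R]_N :=
  match t with
  | 0 => u 0%N
  | t'.+1 => \col_i
      (dotv (hadamard (k (hist phi t) i) (loss_row R (phi t) i))
            (estimate k h u phi t')
       + dotv (hadamard (h (hist phi t) i) (loss_row R (phi t) i)) (u t))
  end.

(* In the optimization problem [M] stands for P(t-1), [m] for varphi_{i|t}, [psi] for
   psi_i(t). *)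
Definition feasible (R : realType) (N : nat) (m : 'cV[R]_N) (psi : R)
    (k h : 'cV[R]_N) : Prop :=
  dotv (hadamard (k + h) m) (const_mx 1) = 1 /\ sqnorm (hadamard k m) <= psi.

Definition cost (R : realType) (N : nat) (sigma : R) (M : 'M[R]_N)
    (m k h : 'cV[R]_N) : R :=
  dotv (hadamard k m) (M *m hadamard k m)
  + sigma ^+ 2 * sqnorm (hadamard h m).

Definition optimal (R : realType) (N : nat) (sigma : R) (M : 'M[R]_N)
    (m : 'cV[R]_N) (psi : R) (k h : 'cV[R]_N) : Prop :=
  feasible m psi k h /\
  forall k' h', feasible m psi k' h' ->
    cost sigma M m k h <= cost sigma M m k' h'.

(* The law is only compared on measurable sets: off them the values of a
   measure are unspecified. *)
Definition gaussian d (T : measurableType d) (R : realType)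
    (P : probability T R) (X : {RV P >-> R}) : Prop :=
  exists m s : R, s != 0 /\
    forall A, measurable A -> distribution P X A = normal_prob m s A.

Definition mutually_independent d (T : measurableType d) (R : realType)
    (P : probability T R) (I : eqType) (D : pred I)
    (X : I -> {RV P >-> bool}) : Prop :=
  forall (s : seq I) (b : I -> bool), uniq s -> all D s ->
    P (\big[setI/setT]_(l <- s) (X l @^-1` [set b l])) =
    (\prod_(l <- s) P (X l @^-1` [set b l]))%E.

Definition sigma_gen d d' (T : measurableType d) (T' : measurableType d')
    (R : realType) (P : probability T R) (I : Type)
    (X : I -> {RV P >-> T'}) : set (set T) :=
  <<s [set A | exists l B, measurable B /\ A = X l @^-1` B] >>.

Definition independent_families d d1 d2 (T : measurableType d)
    (T1 : measurableType d1) (T2 : measurableType d2) (R : realType)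
    (P : probability T R) (I J : Type)
    (X : I -> {RV P >-> T1}) (Y : J -> {RV P >-> T2}) : Prop :=
  forall A B, sigma_gen X A -> sigma_gen Y B -> P (A `&` B) = (P A * P B)%E.

Section Model.
Context d (T : measurableType d) (R : realType) (P : probability T R).
Context (N : nat).
(* [v (i, t)] is the noise of node i at time t; [phi (i, j, t)] is true iff
   node i receives the packet of node j at time t. *)
Variables (v : 'I_N * nat -> {RV P >-> R}).
Variables (phi : 'I_N * 'I_N * nat -> {RV P >-> bool}).

Definition losses (w : T) (t : nat) : lossmx N := \matrix_(i, j) phi (i, j, t) w.

Definition loss_event (l : nat -> lossmx N) (t : nat) : set T :=
  [set w | forall s, (s <= t)%N -> losses w s = l s].

Lemma measurable_loss_event l t : measurable (loss_event l t).
Proof.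
rewrite (_ : loss_event l t =
  \bigcap_(s in [set s | (s <= t)%N]) \bigcap_(ij in [set: 'I_N * 'I_N])
    (phi (ij, s) @^-1` [set l s ij.1 ij.2])); last first.
  apply/seteqP; split=> w /= H s st => [[i j] _ /=|].
    by rewrite -(H s st) mxE.
  by apply/matrixP => i j; rewrite mxE; exact: (H s st (i, j)).
apply: bigcap_measurableType => s _.
apply: fin_bigcap_measurable => [|ij _]; first exact: finite_finset.
exact: measurable_funPTI.
Qed.

(* Conditional probability given the losses [l] at times 0, ..., t; only
   meaningful when [loss_event l t] has positive probability.  Expectations
   under it are the E_v given these packet losses. *)
Definition cond_prob (l : nat -> lossmx N) (t : nat) : probability T R :=
  mnormalize (mrestr P (measurable_loss_event l t)) P.

Variables (dsig : nat -> R) (k h : policy N 'cV[R]_N).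

Definition measurement (w : T) (t : nat) : 'cV[R]_N :=
  \col_i (dsig t + v (i, t) w).

Definition error (i : 'I_N) (t : nat) (w : T) : R :=
  estimate k h (measurement w) (losses w) t i 0 - dsig t.

(* The matrix P(t) along the losses [l]. *)
Definition error_cov (l : nat -> lossmx N) (t : nat) : 'M[R]_N :=
  \matrix_(i, j) fine (covariance (cond_prob l t) (error i t) (error j t)).

End Model.

(* Main.v *)
(* Given the losses up to time t, the error at node i is an affine function of
   the noises, whose joint law is unchanged by the conditioning; its variance is
   therefore the cost minimized by the optimal weights, at M = P(t-1).  The
   choice k = 0, h = 1/n on the n received neighbors costs exactly sigma^2/n,
   and moving a small weight e from h to the coefficient k_ii changes the cost
   by - 2 e sigma^2/n + O(e^2), which is negative whatever P(t-1) is, while the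
   norm constraint e^2 <= psi is slack.  Hence the minimum is strictly smaller. *)
From HB Require Import structures.
Require Import Defs.
From mathcomp Require Import ring measurable_realfun.

Set Implicit Arguments.
Unset Strict Implicit.
Unset Printing Implicit Defensive.

Import Order.TTheory GRing.Theory Num.Theory.

Local Open Scope classical_set_scope.
Local Open Scope ring_scope.

(** * The one-step optimization problem *)

(** The decrease equals [e * (2 * b - e * (a + b))], so it suffices to keep [e * (a + b)] below
    [2 * b]. *)
Lemma quadratic_lt (R : realType) (a b psi : R) : 0 < b -> 0 < psi ->
  exists e : R, [/\ 0 < e, e ^+ 2 <= psi & e ^+ 2 * a + b * (1 - e) ^+ 2 < b].
Proof.
(* [c] dominates [a + b] and is positive for either sign of [a], so [e <= b / c] gives
   [e * (a + b) <= b]. *)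
move=> b0 psi0; set c := Num.max a 0 + b.
have c0 : 0 < c by rewrite ltr_wpDl// le_max lexx orbT.
have ac : a + b <= c by rewrite lerD2r le_max lexx.
(* The bounds by [psi] and by 1 together give [e ^+ 2 <= psi]. *)
pose e := Num.min (b / c) (Num.min psi 1).
have e0 : 0 < e by rewrite !lt_min divr_gt0//= psi0 ltr01.
have ebc : e * c <= b by rewrite -ler_pdivlMr// /e ge_min lexx.
have ep : e <= psi by rewrite /e !ge_min lexx orbT.
have e1 : e <= 1 by rewrite /e !ge_min lexx !orbT.
exists e; split => //.
  by rewrite expr2 (le_trans _ ep)// ler_piMl// ltW.
have : e * (a + b) < 2 * b.
  rewrite (@le_lt_trans _ _ b)//; last by rewrite ltr_pMl// ltr1n.
  by rewrite (le_trans _ ebc)// ler_wpM2l// ltW.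
rewrite -(ltr_pM2l e0) => H; rewrite -subr_gt0.
rewrite (_ : _ - _ = e * (2 * b) - e * (e * (a + b))) ?subr_gt0//; ring.
Qed.

Lemma optimal_cost_lt (R : realType) (N : nat) (sigma psi : R) (M : 'M[R]_N)
    (B : {set 'I_N}) (m k h : 'cV[R]_N) (i : 'I_N) :
  0 < sigma -> 0 < psi -> (forall j, m j 0 = (j \in B)%:R) -> i \in B ->
  optimal sigma M m psi k h -> cost sigma M m k h < sigma ^+ 2 / #|B|%:R.
Proof.
move=> sigma0 psi0 mB iB [_ opt].
have B0 : 0 < #|B|%:R :> R by rewrite ltr0n card_gt0; apply/set0Pn; exists i.
set n : R := #|B|%:R in B0 *.
have b0 : 0 < sigma ^+ 2 / n by rewrite divr_gt0// exprn_gt0.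
have [e [e0 epsi elt]] := quadratic_lt (M i i) b0 psi0.
(* Masking by [m], the indicator of [B], fixes [k'] and restricts [h'] to [B]. The cost of this pair
   is the quadratic of [quadratic_lt] with [a = M i i] and [b = sigma ^+ 2 / n]. *)
pose k' : 'cV[R]_N := \col_j (e * (j == i)%:R).
pose h' : 'cV[R]_N := const_mx ((1 - e) / n).
have k'm : hadamard k' m = k'.
  apply/matrixP => j j0; rewrite !mxE mB.
  by case: eqP => [->|]; rewrite ?iB ?mulr1// mulr0 mul0r.
have pickl (F : 'I_N -> R) : \sum_j k' j 0 * F j = e * F i.
  rewrite (bigD1 i)//= mxE eqxx mulr1 big1 ?addr0// => j /negPf ji.
  by rewrite mxE ji mulr0 mul0r.
have summ : \sum_j m j 0 = n.
  under eq_bigr do rewrite mB.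
  by rewrite -natr_sum /n -sum1_card [in RHS]big_mkcond.
have summ2 : \sum_j m j 0 * m j 0 = n.
  rewrite -summ; apply: eq_bigr => j _.
  by rewrite mB; case: (_ \in _); rewrite ?mulr1 ?mulr0.
have hm : sqnorm (hadamard h' m) = ((1 - e) / n) ^+ 2 * n.
  rewrite /sqnorm /dotv -summ2 mulr_sumr summ2.
  by apply: eq_bigr => j _; rewrite !mxE expr2 mulrACA.
have km : sqnorm (hadamard k' m) = e ^+ 2.
  by rewrite k'm /sqnorm /dotv pickl mxE eqxx mulr1 expr2.
apply: le_lt_trans elt; apply: (le_trans (opt k' h' _)).
  split; last by rewrite km.
  rewrite /dotv.
  under eq_bigr do rewrite !mxE mulr1 mulrDl.
  rewrite big_split/= -mulr_sumr summ divfK ?gt_eqF//.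
  transitivity (e + (1 - e)); last by rewrite addrC subrK.
  congr (_ + _); transitivity (e * m i 0); last by rewrite mB iB mulr1.
  rewrite -(pickl (m ^~ 0)).
  by apply: eq_bigr => j _; rewrite mxE.
rewrite /cost hm k'm /dotv pickl mxE.
under eq_bigr do rewrite mulrC.
rewrite pickl mulrA -expr2 lerD2l.
rewrite le_eqVlt; apply/orP; left; apply/eqP; field.
by rewrite gt_eqF.
Qed.

(** * Covariance of affine combinations of square-integrable variables *)

Section Covariance.
Context d (T : measurableType d) (R : realType) (P : probability T R).
Implicit Types X Y Z : T -> R.

(** Finiteness is what lets [fine] commute with sums and products in the bilinearity lemmas
    below. *)
Lemma Lfun2_covariance_fin_num X Y :
  X \in Lfun P 2%:E -> Y \in Lfun P 2%:E -> covariance P X Y \is a fin_num.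
Proof.
move=> X2 Y2; have Pfin : P setT \is a fin_num by rewrite fin_num_measure.
have XY1 := Lfun2_mul_Lfun1 X2 Y2.
exact: covariance_fin_num (Lfun_subset12 Pfin X2) (Lfun_subset12 Pfin Y2) XY1.
Qed.

Lemma fine_covarianceDl X Y Z :
    X \in Lfun P 2%:E -> Y \in Lfun P 2%:E -> Z \in Lfun P 2%:E ->
  fine (covariance P (X \+ Y) Z) =
  fine (covariance P X Z) + fine (covariance P Y Z).
Proof.
by move=> X2 Y2 Z2; rewrite covarianceDl// fineD// Lfun2_covariance_fin_num.
Qed.

Lemma fine_covarianceZl a X Z : X \in Lfun P 2%:E -> Z \in Lfun P 2%:E ->
  fine (covariance P (a \o* X) Z) = a * fine (covariance P X Z).
Proof.
move=> X2 Z2; have Pfin : P setT \is a fin_num by rewrite fin_num_measure.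
have XZ1 := Lfun2_mul_Lfun1 X2 Z2.
rewrite (covarianceZl _ (Lfun_subset12 Pfin X2) (Lfun_subset12 Pfin Z2) XZ1).
by rewrite fineM// Lfun2_covariance_fin_num.
Qed.

(** This form exposes the pointwise operations handled by the linearity lemmas, so that induction on
    [r] applies. *)
Lemma affine_funE (I : Type) (r : seq I) (a : I -> R) (X : I -> T -> R) c :
  (fun w => \sum_(x <- r) a x * X x w + c) =
  foldr (fun x Y => (a x \o* X x) \+ Y) (cst c) r.
Proof.
apply/funext => w; elim: r => [|x r IH] /=; first by rewrite big_nil add0r.
by rewrite big_cons -addrA IH [a x * _]mulrC.
Qed.

Lemma Lfun2_affine (I : Type) (r : seq I) (a : I -> R) (X : I -> T -> R) c :
    (forall x, X x \in Lfun P 2%:E) ->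
  (fun w => \sum_(x <- r) a x * X x w + c) \in Lfun P 2%:E.
Proof.
move=> X2; rewrite affine_funE; elim: r => [|x r IH] /=; first exact: Lfun_cst.
have aX : a x \o* X x \in Lfun P 2%:E by rewrite Lfun_scale ?ler1n.
have [_ LD] := @Lfun_addr_closed _ _ _ P 2%:E (lee1n 2).
exact: LD _ _ aX IH.
Qed.

Lemma fine_covariance_affinel (I : Type) (r : seq I) (a : I -> R)
    (X : I -> T -> R) c Z :
    (forall x, X x \in Lfun P 2%:E) -> Z \in Lfun P 2%:E ->
  fine (covariance P (fun w => \sum_(x <- r) a x * X x w + c) Z) =
  \sum_(x <- r) a x * fine (covariance P (X x) Z).
Proof.
move=> X2 Z2; have := Lfun2_affine _ a c X2.
rewrite affine_funE; elim: r => [|x r IH] L2 /=.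
  by rewrite covariance_cst_l big_nil.
rewrite big_cons fine_covarianceDl ?fine_covarianceZl ?Lfun_scale ?ler1n//.
  by rewrite IH// => r'; rewrite -affine_funE; exact: Lfun2_affine.
by rewrite -affine_funE; exact: Lfun2_affine.
Qed.

Lemma fine_covariance_affine (I : Type) (r : seq I) (a : I -> R)
    (X : I -> T -> R) c :
    (forall x, X x \in Lfun P 2%:E) ->
  let Y w := \sum_(x <- r) a x * X x w + c in
  fine (covariance P Y Y) =
  \sum_(x <- r) \sum_(y <- r) a x * a y * fine (covariance P (X x) (X y)).
Proof.
move=> X2 Y; rewrite fine_covariance_affinel//; last exact: Lfun2_affine.
apply: eq_bigr => x _; rewrite covarianceC fine_covariance_affinel//.
by rewrite mulr_sumr; apply: eq_bigr => y _; rewrite mulrA covarianceC.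
Qed.

(** With mean zero, the variance is the integral of the square, that is, the squared norm in L2. *)
Lemma Lfun2_centered (X : {RV P >-> R}) :
  ('E_P[X] = 0)%E -> ('V_P[X] < +oo)%E -> (X : T -> R) \in Lfun P 2%:E.
Proof.
move=> EX0; rewrite /variance unlock EX0/= unlock => VX.
apply/andP; split; rewrite inE/=; first exact: measurable_funPT.
rewrite /finite_norm unlock poweR_lty//.
apply: le_lt_trans VX; rewrite le_eqVlt; apply/orP; left; apply/eqP.
apply: eq_integral => x _ /=.
rewrite powR_mulrn ?normr_ge0// real_normK ?num_real//.
by rewrite -[RHS]/(((X x - 0) * (X x - 0))%:E) subr0 expr2.
Qed.

End Covariance.

(** * Two probabilities that agree on a sub-sigma-algebra *)

Section SubSigmaAlgebra.
Context d (T : measurableType d) (R : realType) (P Q : probability T R).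
Variable G : set (set T).
Hypothesis G_measurable : <<s G>> `<=` measurable.
Hypothesis PQ : forall A, <<s G>> A -> P A = Q A.

Lemma expectation_sub_sigma (f : T -> R) :
  measurable_fun [set: g_sigma_algebraType G] f -> ('E_P[f] = 'E_Q[f])%E.
Proof.
move=> mf.
have mfT : measurable_fun [set: T] f.
  by move=> _ B mB; apply: G_measurable; exact: mf.
pose mixF := isMeasurableFun.Build _ _ _ _ f mfT.
pose F : {mfun T >-> R} := HB.pack f mixF.
(* Change of variables: both sides are integrals of [g] against the law of [f], and the two laws
   agree since preimages under [f] lie in the sigma-algebra generated by [G]. It is applied to the
   positive and negative parts of [EFin]. *)
have pushE (g : R -> \bar R) :
    measurable_fun [set: R] g -> (forall x, 0 <= g x)%E ->
    (\int[P]_x g (f x) = \int[Q]_x g (f x))%E.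
  move=> mg g0.
  transitivity (\int[pushforward P F]_x g x)%E.
    by rewrite ge0_integral_pushforward//; exact: mfT.
  transitivity (\int[pushforward Q F]_x g x)%E.
    apply: eq_measure_integral => A mA _; apply: PQ.
    by rewrite -[X in <<s G>> X]setTI; exact: mf.
  by rewrite ge0_integral_pushforward//; exact: mfT.
have mE : measurable_fun [set: R] (EFin : R -> \bar R).
  exact/measurable_EFinP.
rewrite unlock [LHS]integralE [RHS]integralE; congr (_ - _)%E.
- rewrite (funepos_comp EFin f).
  exact: (pushE _ (measurable_funepos mE) (funepos_ge0 _)).
- rewrite (funeneg_comp EFin f).
  exact: (pushE _ (measurable_funeneg mE) (funeneg_ge0 _)).
Qed.

Lemma covariance_sub_sigma (f g : T -> R) :
  measurable_fun [set: g_sigma_algebraType G] f ->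
  measurable_fun [set: g_sigma_algebraType G] g ->
  covariance P f g = covariance Q f g.
Proof.
move=> mf mg; rewrite unlock !expectation_sub_sigma//.
by apply: measurable_funM; exact: measurable_funB.
Qed.

End SubSigmaAlgebra.

Lemma expectation_ae_eq d (T : measurableType d) (R : realType)
    (P : probability T R) (f g : T -> R) :
  measurable_fun setT f -> measurable_fun setT g ->
  {ae P, forall w, f w = g w} -> ('E_P[f] = 'E_P[g])%E.
Proof.
move=> mf mg fg; rewrite unlock; apply: ae_eq_integral => //.
- exact/measurable_EFinP.
- exact/measurable_EFinP.
- by apply: filterS fg => w -> _.
Qed.

Lemma covariance_ae_eq d (T : measurableType d) (R : realType)
    (P : probability T R) (f f' g g' : T -> R) :
  measurable_fun setT f -> measurable_fun setT f' ->
  measurable_fun setT g -> measurable_fun setT g' ->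
  {ae P, forall w, f w = f' w} -> {ae P, forall w, g w = g' w} ->
  covariance P f g = covariance P f' g'.
Proof.
move=> mf mf' mg mg' ff' gg'; rewrite unlock.
rewrite (expectation_ae_eq mf mf' ff') (expectation_ae_eq mg mg' gg').
apply: expectation_ae_eq; try by apply: measurable_funM; exact: measurable_funB.
apply: filterS2 ff' gg' => w fw gw.
exact: (congr2 (fun x y => (x - _) * (y - _)) fw gw).
Qed.

(** * Conditioning on the packet losses *)

(** Causality: masks and policies up to time [t] read only the losses up to [t]. *)
Lemma estimate_eq_losses (R : realType) (N : nat) (k h : policy N 'cV[R]_N)
    (u : nat -> 'cV[R]_N) (l l' : nat -> lossmx N) (t : nat) :
  (forall s, (s <= t)%N -> l s = l' s) ->
  estimate k h u l t = estimate k h u l' t.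
Proof.
elim: t => [//|t IH] ll' /=.
have -> : hist l t.+1 = hist l' t.+1.
  by apply/eq_in_map => s; rewrite mem_iota => /ll'.
rewrite IH => [|s st]; last by rewrite ll'// leqW.
by rewrite ll'.
Qed.

Section Conditioning.
Context d (T : measurableType d) (R : realType) (P : probability T R).
Context (N : nat).
Variables (v : 'I_N * nat -> {RV P >-> R}).
Variables (phi : 'I_N * 'I_N * nat -> {RV P >-> bool}).
Variables (dsig : nat -> R) (k h : policy N 'cV[R]_N).

Lemma sigma_gen_measurable d' (T' : measurableType d') (I : Type)
  (X : I -> {RV P >-> T'}) : sigma_gen X `<=` measurable.
Proof.
apply: smallest_sub; first exact: sigma_algebra_measurable.
by move=> _ [i [B [mB ->]]]; exact: measurable_funPTI.
Qed.

Lemma loss_event_sigma_gen l t : sigma_gen phi (loss_event phi l t).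
Proof.
set G := [set A | exists a B, measurable B /\ A = phi a @^-1` B].
(* Membership is read as measurability for the generated sigma-algebra, so that closure under
   intersections applies; independence from [v] can then be used on this event. *)
change (@measurable _ (g_sigma_algebraType G) (loss_event phi l t)).
rewrite (_ : loss_event phi l t =
  \bigcap_(s in [set s | (s <= t)%N]) \bigcap_(ij in [set: 'I_N * 'I_N])
    (phi (ij, s) @^-1` [set l s ij.1 ij.2])); last first.
  apply/seteqP; split=> w /= H s st => [[i j] _ /=|].
    by rewrite -(H s st) mxE.
  by apply/matrixP => i j; rewrite mxE; exact: (H s st (i, j)).
apply: bigcap_measurableType => s _.
apply: fin_bigcap_measurable => [|ij _]; first exact: finite_finset.
by apply: sub_sigma_algebra; exists (ij, s), [set l s ij.1 ij.2].
Qed.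

Lemma cond_probE l t A : (0 < P (loss_event phi l t))%E ->
  cond_prob phi l t A =
  (P (A `&` loss_event phi l t) * (fine (P (loss_event phi l t)))^-1%:E)%E.
Proof.
move=> E0; rewrite /cond_prob /= /mnormalize /= /mrestr setTI.
(* [mnormalize] falls back on [P] when the total mass is zero or infinite; both cases are excluded
   here. *)
rewrite gt_eqF//= lt_eqF// ltey_eq fin_num_measure//.
exact: measurable_loss_event.
Qed.

(** Independence factors the probability of the intersection, and normalization cancels the factor
    of the loss event. *)
Lemma cond_prob_sigma_gen l t A : independent_families v phi ->
  (0 < P (loss_event phi l t))%E -> sigma_gen v A ->
  P A = cond_prob phi l t A.
Proof.
move=> vphi E0 vA; rewrite cond_probE// vphi//; last exact: loss_event_sigma_gen.
have Efin : P (loss_event phi l t) \is a fin_num.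
  by rewrite fin_num_measure//; exact: measurable_loss_event.
rewrite -{1}(fineK Efin) -muleA -EFinM divff ?mule1//.
by rewrite gt_eqF// fine_gt0// E0 ltey_eq Efin.
Qed.

Lemma ae_cond_prob l t (A : set T) : (0 < P (loss_event phi l t))%E ->
  loss_event phi l t `<=` A -> {ae cond_prob phi l t, forall w, A w}.
Proof.
move=> E0 EA; have mE := measurable_loss_event phi l t.
exists (~` loss_event phi l t); split.
- exact: measurableC.
- by rewrite cond_probE// setICl measure0 mul0e.
- by move=> w; apply: contra_not => /EA.
Qed.

(** The losses are frozen at [l] on the whole sample space, which leaves a function of the noise
    alone. *)
Definition error_along (l : nat -> lossmx N) (t : nat) (i : 'I_N) (w : T) : R :=
  estimate k h (measurement v dsig w) l t i 0 - dsig t.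

Lemma error_loss_event l t i w : loss_event phi l t w ->
  error v phi dsig k h i t w = error_along l t i w.
Proof. by move=> /estimate_eq_losses E; rewrite /error /error_along E. Qed.

(** One index type for the inputs of an update: previous errors on the left, fresh noises on the
    right. *)
Definition source (l : nat -> lossmx N) (t : nat) (x : 'I_N + 'I_N) : T -> R :=
  match x with inl j => error_along l t j | inr j => v (j, t.+1) end.

Definition source_weight (l : nat -> lossmx N) (t : nat) (i : 'I_N)
    (x : 'I_N + 'I_N) : R :=
  match x with
  | inl j => hadamard (k (hist l t.+1) i) (loss_row R (l t.+1) i) j 0
  | inr j => hadamard (h (hist l t.+1) i) (loss_row R (l t.+1) i) j 0
  end.

Lemma error_along0 l i : error_along l 0 i = v (i, 0%N).
Proof. by apply/funext => w; rewrite /error_along /= mxE addrAC subrr add0r. Qed.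

(** Estimates and measurements are [dsig] plus an error or a noise; [c] collects the deterministic
    terms, which covariances ignore. *)
Lemma error_alongS l t i : exists c,
  error_along l t.+1 i =
  (fun w => \sum_x source_weight l t i x * source l t x w + c).
Proof.
exists ((\sum_j source_weight l t i (inl j)) * dsig t
  + (\sum_j source_weight l t i (inr j)) * dsig t.+1 - dsig t.+1).
apply/funext => w; rewrite big_sumType/= {1}/error_along [estimate _ _ _ _ _]/=.
rewrite mxE addrA; congr (_ - _); rewrite addrACA; congr (_ + _).
  rewrite mulr_suml -big_split/=; apply: eq_bigr => j _.
  by rewrite -mulrDr subrK.
rewrite mulr_suml -big_split/=; apply: eq_bigr => j _.
by rewrite [measurement _ _ _ _ _ _]mxE mulrDr addrC.
Qed.

(** Induction principle for measurability, square integrability and uncorrelatedness. The bound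
    [s <= t] excludes future noises, as the last use requires. *)
Lemma error_along_ind (K : (T -> R) -> Prop) (l : nat -> lossmx N) (t : nat) :
    (forall j s, (s <= t)%N -> K (v (j, s))) ->
    (forall (r : seq ('I_N + 'I_N)) a (X : 'I_N + 'I_N -> T -> R) c,
      (forall x, K (X x)) -> K (fun w => \sum_(x <- r) a x * X x w + c)) ->
  forall i, K (error_along l t i).
Proof.
move=> + Kaff; elim: t => [|t IH] Kv i; first by rewrite error_along0; exact: Kv.
have [c ->] := error_alongS l t i; apply: Kaff => -[j|j] /=; last exact: Kv.
by apply: IH => j' s st; apply: Kv; exact: leqW.
Qed.

Let G := [set A | exists a B, measurable B /\ A = v a @^-1` B].

Lemma sigma_gen_error_along l t i :
  measurable_fun [set: g_sigma_algebraType G] (error_along l t i).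
Proof.
apply: (error_along_ind
  (K := fun f => measurable_fun [set: g_sigma_algebraType G] f)).
  move=> j s _ _ B mB; rewrite setTI; apply: sub_sigma_algebra.
  by exists (j, s), B.
move=> r a X c mX; apply: measurable_funD => //.
by apply: measurable_sum => x; exact: measurable_funM.
Qed.

Lemma measurable_error_along l t i : measurable_fun [set: T] (error_along l t i).
Proof.
move=> _ B mB; apply: (@sigma_gen_measurable _ _ _ v).
exact: sigma_gen_error_along.
Qed.

Lemma measurable_error t i : measurable_fun [set: T] (error v phi dsig k h i t).
Proof.
move=> _ B mB; rewrite setTI.
(* Pads a list to a sequence; for a history of length [t.+1] the default starts after time [t]. *)
pose L (s : seq (lossmx N)) n := nth (const_mx false) s n.
rewrite (_ : _ @^-1` B = \bigcup_(s : seq (lossmx N))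
    (loss_event phi (L s) t `&` error_along (L s) t i @^-1` B)).
  apply: countable_bigcupT_measurable => [|s]; first exact: countableP.
  apply: measurableI.
    exact: measurable_loss_event.
  by rewrite -[X in measurable X]setTI; exact: measurable_error_along.
apply/seteqP; split => [w Bw|w [s _ [Ew]]].
  have Ew : loss_event phi (L (hist (losses phi w) t)) t w.
    by move=> s st; rewrite /L nth_mkseq.
  exists (hist (losses phi w) t) => //.
  by split=> //=; rewrite -error_loss_event.
by rewrite /= -error_loss_event.
Qed.

Hypothesis v_indep : independent_families v phi.

Lemma cond_covariance_error l t i j : (0 < P (loss_event phi l t))%E ->
  covariance (cond_prob phi l t)
    (error v phi dsig k h i t) (error v phi dsig k h j t) =
  covariance P (error_along l t i) (error_along l t j).
Proof.
move=> E0; rewrite (@covariance_sub_sigma _ _ _ P (cond_prob phi l t) G).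
- apply: covariance_ae_eq; try exact: measurable_error;
    try exact: measurable_error_along.
  + by apply: ae_cond_prob => // w; exact: error_loss_event.
  + by apply: ae_cond_prob => // w; exact: error_loss_event.
- exact: sigma_gen_measurable.
- by move=> A; exact: cond_prob_sigma_gen.
- exact: sigma_gen_error_along.
- exact: sigma_gen_error_along.
Qed.

(** * The variance recursion *)

Variable sigma : R.
Hypothesis v_mean : forall a, ('E_P[v a] = 0)%E.
Hypothesis v_var : forall a, ('V_P[v a] = (sigma ^+ 2)%:E)%E.
Hypothesis v_uncorrelated :
  forall a b, a != b -> covariance P (v a) (v b) = 0%E.

Lemma Lfun2_noise a : (v a : T -> R) \in Lfun P 2%:E.
Proof. by apply: Lfun2_centered; rewrite ?v_mean// v_var ltry. Qed.

Lemma Lfun2_error_along l t i : error_along l t i \in Lfun P 2%:E.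
Proof.
apply: (error_along_ind (K := fun f => f \in Lfun P 2%:E)).
  by move=> j s _; exact: Lfun2_noise.
by move=> r a X c X2; exact: Lfun2_affine.
Qed.

Lemma error_noise_uncorrelated l t s i j : (t < s)%N ->
  fine (covariance P (error_along l t i) (v (j, s))) = 0.
Proof.
move=> ts.
(* Square integrability is carried along because linearity of the covariance requires it. *)
pose K f := f \in Lfun P 2%:E /\ fine (covariance P f (v (j, s))) = 0.
suff [] : K (error_along l t i) by [].
apply: (error_along_ind (K := K)).
  move=> j' s' s't; split; first exact: Lfun2_noise.
  have s's := ltn_eqF (leq_ltn_trans s't ts).
  by rewrite v_uncorrelated// xpair_eqE negb_and s's orbT.
move=> r a X c KX; have X2 x := (KX x).1; split; first exact: Lfun2_affine.
rewrite fine_covariance_affinel//; last exact: Lfun2_noise.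
by rewrite big1// => x _; rewrite (KX x).2 mulr0.
Qed.

(** The double sum over [source] has four blocks: errors give the quadratic form in P(t), both mixed
    blocks vanish, and the noise block reduces to its diagonal. *)
Lemma variance_error_along l t i : (0 < P (loss_event phi l t))%E ->
  fine ('V_P[error_along l t.+1 i])%E =
  cost sigma (error_cov v phi dsig k h l t) (loss_row R (l t.+1) i)
    (k (hist l t.+1) i) (h (hist l t.+1) i).
Proof.
move=> E0; have [c ->] := error_alongS l t i.
rewrite /variance fine_covariance_affine => [|[j|j]]; last 2 first.
- exact: Lfun2_error_along.
- exact: Lfun2_noise.
rewrite big_sumType/= /cost; congr (_ + _); last rewrite mulr_sumr.
- apply: eq_bigr => j _; rewrite big_sumType/= [X in _ + X]big1 ?addr0.
    rewrite [(_ *m _) _ _]mxE mulr_sumr; apply: eq_bigr => j' _.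
    by rewrite !mxE cond_covariance_error//; ring.
  by move=> j' _; rewrite error_noise_uncorrelated ?mulr0.
- apply: eq_bigr => j _; rewrite big_sumType/= big1 ?add0r => [|j' _]; last first.
    by rewrite covarianceC error_noise_uncorrelated ?mulr0.
  rewrite (bigD1 j)//= big1 ?addr0 => [|j' jj']; last first.
    by rewrite v_uncorrelated ?mulr0// xpair_eqE eqxx andbT eq_sym.
  by rewrite -/('V_P[v (j, t.+1)])%E v_var/=; ring.
Qed.

End Conditioning.

Theorem proposition5p1 (R : realType) (N : nat) (hN : (1 < N)%N)
    (* the graph *)
    (adj : rel 'I_N) (adj_sym : symmetric adj) (adj_irr : irreflexive adj)
    (disp : measure_display) (T : measurableType disp) (P : probability T R)
    (* signal and measurement noise *)
    (dsig : nat -> R) (sigma : R) (sigma_gt0 : 0 < sigma)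
    (v : 'I_N * nat -> {RV P >-> R})
    (v_gaussian : forall a, gaussian (v a))
    (v_mean : forall a, ('E_P[v a] = 0)%E)
    (v_var : forall a, ('V_P[v a] = (sigma ^+ 2)%:E)%E)
    (v_uncorrelated : forall a b, a != b -> covariance P (v a) (v b) = 0%E)
    (* packet losses *)
    (phi : 'I_N * 'I_N * nat -> {RV P >-> bool})
    (phi_self : forall i t w, phi (i, i, t) w = true)
    (phi_nonnbr : forall i j t w, j \notin nbhd adj i -> phi (i, j, t) w = false)
    (phi_indep : mutually_independent
       [pred a : 'I_N * 'I_N * nat | a.1.1 != a.1.2] phi)
    (phi_v_indep : independent_families v phi)
    (* thresholds *)
    (gamma_max : R) (gamma_gt0 : 0 < gamma_max) (gamma_lt1 : gamma_max < 1)
    (psi : policy N R)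
    (psi_gt0 : forall (l : nat -> lossmx N) t i, (1 <= t)%N ->
       (0 < P (loss_event phi l t))%E -> 0 < psi (hist l t) i)
    (psi_bound : forall (l : nat -> lossmx N) t i, (1 <= t)%N ->
       (0 < P (loss_event phi l t))%E ->
       psi (hist l t) i + Num.sqrt (psi (hist l t) i) *
         \sum_(j in Theta adj (l t) i) Num.sqrt (psi (hist l t) j)
       <= gamma_max)
    (* optimal weights *)
    (k h : policy N 'cV[R]_N)
    (kh_optimal : forall (l : nat -> lossmx N) t i, (1 <= t)%N ->
       (0 < P (loss_event phi l t))%E ->
       optimal sigma (error_cov v phi dsig k h l t.-1) (loss_row R (l t) i)
         (psi (hist l t) i) (k (hist l t) i) (h (hist l t) i)) :
  forall (i : 'I_N) (t : nat) (l : nat -> lossmx N), (1 <= t)%N ->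
    (0 < P (loss_event phi l t))%E ->
    ('V_(cond_prob phi l t)[error v phi dsig k h i t]
       < (sigma ^+ 2 / #|rnbhd adj (l t) i|%:R)%:E)%E.
Proof.
move=> i [//|t] l _ E0.
have mE := measurable_loss_event phi l.
(* Positivity at the earlier time makes the conditioning inside [error_cov] meaningful. *)
have E0' : (0 < P (loss_event phi l t))%E.
  apply: lt_le_trans E0 _; apply: le_measure; rewrite ?inE//.
  by move=> w lw s st; apply: lw; exact: leqW.
(* A sample point realizing [l] transfers the pointwise properties of [phi] to [l]. *)
have [w lw] : loss_event phi l t.+1 !=set0.
  by apply/set0P; apply: contraTneq E0 => ->; rewrite measure0 ltxx.
have lE a b : l t.+1 a b = phi (a, b, t.+1) w by rewrite -lw// mxE.
rewrite /variance cond_covariance_error// -[covariance _ _ _]fineK; last first.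
  rewrite Lfun2_covariance_fin_num//.
    exact: Lfun2_error_along v_mean v_var _ _ _.
  exact: Lfun2_error_along v_mean v_var _ _ _.
rewrite lte_fin -/('V_P[_])%E.
rewrite (variance_error_along _ _ _ phi_v_indep v_mean v_var)//.
apply: (optimal_cost_lt (i := i) sigma_gt0 (psi_gt0 _ _ i _ E0)) => //.
(* The mask is the indicator of [rnbhd], since packets from outside the neighborhood never
   arrive. *)
- move=> j; rewrite mxE inE lE; case: (boolP (j \in _)) => //= jN.
  by rewrite phi_nonnbr.
- by rewrite !inE eqxx lE phi_self.
- exact: kh_optimal.
Qed.
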